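(* For every integer $k\ge 1$, every arborescence on $k$ vertices is $\left(\sqrt{\frac{4}{3}}\, k \sqrt{k} + \frac{k}{2}\right)$-universal.
   Context: All graphs and digraphs are finite and simple (no loops, no parallel arcs in the same direction); digraphs may contain digons (directed cycles of length 2), oriented graphs may not. The chromatic number $\chi(D)$ of a digraph $D$ is the minimum number of colours in an assignment of colours to the vertices such that adjacent vertices (in either direction) receive different colours. An oriented tree is an orientation of an undirected tree. An arborescence is an oriented tree that is either an out-arborescence (it has a root vertex such that all arcs are directed away from the root) or an in-arborescence (it has a root vertex such that all arcs are directed towards the root). For a real number $c>0$, a digraph $H$ is $c$-universal if every digraph $D$ with $\chi(D)\ge c$ contains $H$ as a (not necessarily induced) subdigraph. *)

(* Defs.v *)
From mathcomp Require Import all_boot all_order all_algebra.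
From mathcomp Require Import reals.
Set Implicit Arguments.
Unset Strict Implicit.
Unset Printing Implicit Defensive.
Import Order.TTheory GRing.Theory Num.Theory.

(* Finite simple digraphs: [arc] being a relation excludes parallel arcs,
   irreflexivity excludes loops, and digons are allowed. *)
Record digraph := Digraph {
  vertex :> finType;
  arc : rel vertex;
  arc_irrefl : irreflexive arc
}.

Definition adjacent (D : digraph) : rel D := fun u v => arc u v || arc v u.

Definition colourable (D : digraph) (n : nat) : bool :=
  [exists f : {ffun D -> 'I_n},
    [forall u : D, forall v : D, adjacent u v ==> (f u != f v)]].

Lemma exists_colourable (D : digraph) : exists n, colourable D n.
Proof.
exists #|D|; apply/existsP; exists [ffun u => enum_rank u].
apply/forallP => u; apply/forallP => v; apply/implyP => uv; rewrite !ffunE.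
apply/eqP => /enum_rank_inj euv; move: uv.
by rewrite euv /adjacent arc_irrefl.
Qed.

Definition chromatic_number (D : digraph) : nat := ex_minn (exists_colourable D).

Definition contains_subdigraph (D H : digraph) : Prop :=
  exists f : H -> D, injective f /\ (forall u v : H, arc u v -> arc (f u) (f v)).

Definition universal (R : realType) (c : R) (H : digraph) : Prop :=
  forall D : digraph,
    (c <= (chromatic_number D)%:R)%R -> contains_subdigraph D H.

(* Bounding the length below by 3 discards the cycles of length 2 that
   [ucycle] sees in every edge of a symmetric relation. *)
Definition acyclic (T : finType) (e : rel T) : Prop :=
  forall c : seq T, 2 < size c -> ~ ucycle e c.

Definition is_tree (T : finType) (e : rel T) : Prop :=
  [/\ 0 < #|T|, forall x y : T, connect e x y & acyclic e].

Definition oriented_graph (D : digraph) : Prop :=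
  forall u v : D, arc u v -> ~~ arc v u.

Definition oriented_tree (D : digraph) : Prop :=
  oriented_graph D /\ is_tree (@adjacent D).

(* [y] lies on every [x]-[z] path; in a tree this path is unique. *)
Definition between (T : finType) (e : rel T) (x y z : T) : Prop :=
  forall p : seq T,
    path e x p -> uniq (x :: p) -> last x p = z -> y \in x :: p.

(* An arc uv is directed away from r when u precedes v on the path from r
   to v in the underlying tree, and towards r when v lies on the path from r
   to u. *)
Definition out_arborescence (D : digraph) : Prop :=
  oriented_tree D /\
  exists r : D, forall u v : D, arc u v -> between (@adjacent D) r u v.

Definition in_arborescence (D : digraph) : Prop :=
  oriented_tree D /\
  exists r : D, forall u v : D, arc u v -> between (@adjacent D) r v u.

Definition arborescence (D : digraph) : Prop :=
  out_arborescence D \/ in_arborescence D.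

(* Main.v *)
Require Import Defs.
From mathcomp Require Import all_boot all_order all_algebra.
From mathcomp Require Import reals boolp.
From mathcomp Require Import zify ring lra.
Import Order.TTheory GRing.Theory Num.Theory.

(** By reversing all arcs, it is enough to embed out-arborescences.  Two
    operations reduce an out-arborescence X on k vertices to a smaller one.

    Stripping all leaves at once costs 2k - 1 colours ([hosts_leaves]).  The
    vertices of out-degree less than k induce a degenerate, hence (2k - 1)-
    colourable digraph.  In the rest of the digraph one embeds X without its
    leaves, and the large out-degrees then provide the leaves greedily.

    If X has l leaves, it is a union of l directed paths, and it embeds in every
    digraph which is not (l k - 1)-colourable ([hosts_branched]).  Suppose that X
    arises from Y by attaching a directed path with p new vertices at w.  It
    suffices to find a set S of few colours such that every vertex outside S
    starts a path with p further vertices in S: then Y is found outside S and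
    the path inside S.  Take S maximal among the sets all of whose strong
    subdigraphs are p-colourable ([maximal_strong_colourable]).  Adding a vertex v
    to S creates a strong subdigraph of chromatic number more than p that contains v,
    and there v starts a path with more than p vertices, by a rooted form of the
    Gallai-Roy theorem ([levels]): in a spanning out-tree with maximal sum of
    depths no arc joins two vertices of the same depth.

    It remains to bound the chromatic number of S, or else to find X inside S.
    Here the recursion runs again, but with cheap absorbing sets: when all
    strong subdigraphs are p-colourable, then for every q there is a set K of
    at most q + p - 1 colours such that every vertex outside K starts a path with
    q further vertices in K ([absorbing]).  It is built like a kernel of an acyclic
    digraph, from the sinks upwards, with strong blocks instead of vertices.
    Attaching the branches one by one shows that X is in S once S needs
    |X| + (l - 1) p colours ([hosts_strong_colourable]), and these costs,
    summed over the branches, amount to at most l k - 1.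

    Finally, let F k = sqrt (4/3) k sqrt k + k/2.  If l k <= F k, the second
    operation finishes.  Otherwise l exceeds sqrt (4/3) sqrt k, and stripping the l
    leaves is affordable since F (k - l) + 2 k <= F k ([chi_bound_step]). *)

(** * Colourings and levels *)

Section Host.
Set Implicit Arguments.
Unset Strict Implicit.
Unset Printing Implicit Defensive.

Variables (V : finType) (e : rel V).
Hypothesis e_irr : irreflexive e.
Implicit Types (x y z : V) (I S K C W Z : {set V}).

Definition colourable_on W n := exists c : V -> nat,
  {in W, forall x, c x < n} /\ {in W &, forall x y, e x y -> c x != c y}.

Lemma colourable_onS W Z n : Z \subset W -> colourable_on W n -> colourable_on Z n.
Proof.
move=> /subsetP sZW [c [c_lt c_ok]]; exists c.
by split=> [x /sZW /c_lt //|x y /sZW Wx /sZW Wy]; apply: c_ok.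
Qed.

Lemma colourable_on_leq W m n : m <= n -> colourable_on W m -> colourable_on W n.
Proof.
move=> le_mn [c [c_lt c_ok]]; exists c.
by split=> [x /c_lt lt_cm|//]; apply: leq_trans le_mn.
Qed.

Lemma colourable_onU W Z m n :
  colourable_on W m -> colourable_on Z n -> colourable_on (W :|: Z) (m + n).
Proof.
move=> [c [c_lt c_ok]] [d [d_lt d_ok]].
exists (fun x => if x \in W then c x else m + d x); split=> [x|x y].
  rewrite inE; case: ifP => [Wx _|_ /= Zx]; last by rewrite ltn_add2l d_lt.
  by apply: leq_trans (c_lt _ Wx) (leq_addr _ _).
rewrite !inE; case: ifP => [Wx _|_ /= Zx]; case: ifP => [Wy _|_ /= Zy] exy.
- exact: c_ok.
- by have := c_lt _ Wx; lia.
- by have := c_lt _ Wy; lia.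
- by rewrite eqn_add2l d_ok.
Qed.

(** A spanning out-forest of [W] with roots in [I], given by depths and parents:
    in this form a subtree is re-hung by changing one parent and some depths. *)
Definition forest W I (lv : V -> nat) (pr : V -> V) := forall x, x \in W ->
  if lv x == 0 then x \in I : Prop
  else [/\ pr x \in W, e (pr x) x & lv x = (lv (pr x)).+1].

Lemma forest_path W I lv pr x : forest W I lv pr -> x \in W ->
  exists2 i, i \in I & exists ys,
    [/\ size ys = lv x, path e i ys, last i ys = x, uniq (i :: ys) &
        {in i :: ys, forall y, (y \in W) && (lv y <= lv x)}].
Proof.
move=> F; move En: (lv x) => n; elim: n x En => [|n IH] x En Wx.
  have:= F x Wx; rewrite En eqxx => Ix; exists x => //; exists [::]; split=> // y.
  by rewrite inE => /eqP->; rewrite Wx En.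
have:= F x Wx; rewrite En /= => -[Wp ep [Ep]].
have [i Ii [ys [sz pth lst un al]]] := IH _ (esym Ep) Wp.
exists i => //; exists (rcons ys x); split.
- by rewrite size_rcons sz.
- by rewrite rcons_path pth lst.
- by rewrite last_rcons.
- rewrite -[_ && _]/(uniq (rcons (i :: ys) x)) rcons_uniq un andbT; apply/negP => /al.
  by rewrite En ltnn andbF.
- move=> y; rewrite -rcons_cons mem_rcons inE => /predU1P[->|/al/andP[-> /leqW//]].
  by rewrite Wx En leqnn.
Qed.

Lemma forest_bound W I lv pr x : forest W I lv pr -> x \in W -> lv x < #|V|.
Proof.
move=> F Wx; have [i _ [ys [<- _ _ un _]]] := forest_path F Wx.
by rewrite -[(size ys).+1]/(size (i :: ys)) -(card_uniqP un) max_card.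
Qed.

(** Re-hanging the subtree of [y] below [x] pushes that subtree one level down.
    The vertex [x] is not in it, since proper descendants of [y] are
    strictly deeper than [y]. *)
Lemma forest_rehang W I lv pr x y : forest W I lv pr ->
  x \in W -> y \in W -> e x y -> lv x = lv y ->
  exists lv' pr', forest W I lv' pr' /\ \sum_(z in W) lv z < \sum_(z in W) lv' z.
Proof.
move=> F Wx Wy exy lxy.
pose up := [rel z u | [&& z \in W, lv z != 0 & u == pr z]].
pose below z := connect up z y.
have belowy : below y by exact: connect0.
have belowP z : z \in W -> z != y -> lv z != 0 -> below z = below (pr z).
  move=> Wz zy lz; apply/idP/idP => [/connectP[[|u p] /=]|bz].
  - by move=> _ yz; rewrite yz eqxx in zy.
  - by case/andP=> /and3P[_ _ /eqP->] pth lst; apply/connectP; exists p.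
  - by apply: connect_trans bz; apply: connect1; rewrite /= Wz lz eqxx.
have below_lv z : below z -> z \in W -> lv y <= lv z ?= iff (z == y).
  move=> bz Wz; apply/leqifP; case: eqP => [->//|/eqP zy].
  case/connectP: bz => p; elim: p z Wz zy => [|u p IH] z Wz zy /=.
    by move=> _ yz; rewrite yz eqxx in zy.
  case/andP=> /and3P[_ lz /eqP Eu] pth lst.
  have:= F z Wz; rewrite (negPf lz) -Eu => -[Wu _ ->].
  case: (eqVneq u y) => [->//|uy].
  by apply: leq_trans (IH _ Wu uy pth lst) _.
have nbx : ~~ below x.
  apply/negP => bx; have [_] := below_lv x bx Wx; rewrite lxy eqxx => /esym/eqP xy.
  by rewrite xy e_irr in exy.
pose lv' z := lv z + below z.
pose pr' z := if z == y then x else pr z.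
exists lv', pr'; split.
  move=> z Wz; rewrite /lv' /pr'.
  case: (eqVneq z y) => [->|zy].
    by rewrite belowy addn1 /= (negPf nbx) addn0 lxy; split.
  have := F z Wz; case: (eqVneq (lv z) 0) => [lz Iz|lz [Wp ep Ep]].
    suff /negPf-> : ~~ below z by rewrite lz.
    by apply/negP => /below_lv/(_ Wz)/ltn_leqif; rewrite zy lz.
  rewrite addn_eq0 (negPf lz) /=; split=> //.
  by rewrite (belowP z) // Ep addSn.
rewrite (bigD1 y) // [ltnRHS](bigD1 y) //= /lv' belowy addn1.
by apply: leq_add => //; apply: leq_sum => z _; apply: leq_addr.
Qed.

(** Reachability of [W] from [I] is expressed by cuts, so that a forest grows
    along any arc that leaves it. *)
Lemma forest_exists W I : I \subset W ->
    (forall Z, I \subset Z -> Z \proper W ->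
       exists z x, [/\ z \in Z, x \in W :\: Z & e z x]) ->
  exists lv pr, forest W I lv pr.
Proof.
move=> sIW cut.
suff grow n Z lv pr : #|W :\: Z| <= n -> I \subset Z -> Z \subset W ->
    forest Z I lv pr -> exists lv' pr', forest W I lv' pr'.
  apply: (grow _ I (fun=> 0) id (leqnn _)) => //.
elim: n Z lv pr => [|n IH] Z lv pr.
  rewrite leqn0 cards_eq0 setD_eq0 => sWZ _ sZW F.
  by exists lv, pr; have /eqP-> : W == Z by rewrite eqEsubset sWZ.
move=> le_n sIZ sZW F; case: (eqVneq Z W) => [<-|nZW]; first by exists lv, pr.
have [|z [x [Zz]]] := cut Z sIZ; first by rewrite properEneq nZW.
rewrite inE => /andP[nZx Wx] ezx.
pose lv' u := if u == x then (lv z).+1 else lv u.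
pose pr' u := if u == x then z else pr u.
apply: (IH (x |: Z) lv' pr').
- have := cardsD1 x (W :\: Z); rewrite !inE nZx Wx /= => Ec.
  rewrite (_ : W :\: (x |: Z) = (W :\: Z) :\ x); first by lia.
  by apply/setP => u; rewrite !inE negb_or -andbA.
- exact: subset_trans (subsetU1 _ _).
- by rewrite subUset sub1set Wx.
have neq u : u \in Z -> (u == x) = false.
  by move=> Zu; apply/negP => /eqP Eu; rewrite -Eu Zu in nZx.
move=> u; rewrite !inE /lv' /pr' => /predU1P[->|Zu].
  by rewrite eqxx /= (neq z) // Zz orbT; split.
rewrite (neq u) //; have:= F u Zu; case: ifP => // _ [Zp ep Ep].
by rewrite (neq (pr u)) // !inE Zp orbT.
Qed.

(** A rooted Gallai-Roy theorem: the depths in a forest with maximal sum of depths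
    form a proper colouring, because an arc inside a level could be used
    to re-hang its head, and a vertex at depth [n] ends a path of the
    forest with [n] arcs. *)
Lemma levels W I : I \subset W ->
    (forall Z, I \subset Z -> Z \proper W ->
       exists z x, [/\ z \in Z, x \in W :\: Z & e z x]) ->
  exists lv : V -> nat, {in W &, forall x y, e x y -> lv x != lv y} /\
    {in W, forall x, exists2 i, i \in I & exists ys,
    [/\ size ys = lv x, path e i ys, last i ys = x, uniq (i :: ys) &
        {subset i :: ys <= W}]}.
Proof.
move=> sIW cut; have [lv0 [pr0 F0]] := forest_exists sIW cut.
(* The sum of depths is bounded, so that re-hanging terminates. *)
pose bnd := \sum_(z in W) #|V|.
suff [lv [pr [F ok]]] : exists lv pr, forest W I lv pr /\
    {in W &, forall x y, e x y -> lv x != lv y}.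
  exists lv; split=> // x Wx; have [i Ii [ys [? ? ? ? al]]] := forest_path F Wx.
  by exists i => //; exists ys; split=> // y /al/andP[].
have le_bnd lv pr : forest W I lv pr -> \sum_(z in W) lv z <= bnd.
  by move=> F; apply: leq_sum => z Wz; apply/ltnW/(forest_bound F Wz).
have [n] := ubnP (bnd - \sum_(z in W) lv0 z).
elim: n lv0 pr0 F0 => // n IH lv pr F lt_n.
have [ok|nok] := pselect {in W &, forall x y, e x y -> lv x != lv y}.
  by exists lv, pr.
have [x [y [Wx Wy exy lxy]]] :
    exists x y, [/\ x \in W, y \in W, e x y & lv x = lv y].
  apply: contrapT => no; apply: nok => x y Wx Wy exy; apply/eqP => lxy.
  by apply: no; exists x, y.
have [lv' [pr' [F' lt]]] := forest_rehang F Wx Wy exy lxy.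
by apply: (IH lv' pr' F'); have := le_bnd _ _ F'; lia.
Qed.

(** A directed path with [n] arcs out of [x] whose vertices other than [x] lie in
    [Z]; the start is exempt because it is often outside of [Z]. *)
Definition walk Z x n := exists ys,
  [/\ size ys = n, path e x ys, uniq (x :: ys) & {subset ys <= Z}].

Lemma walk0 Z x : walk Z x 0.
Proof. by exists [::]. Qed.

Lemma walkS Z Z' x n : Z \subset Z' -> walk Z x n -> walk Z' x n.
Proof.
move=> /subsetP sZ [ys [? ? ? al]]; exists ys; split=> // y /al; exact: sZ.
Qed.

Lemma walk_leq Z x m n : m <= n -> walk Z x n -> walk Z x m.
Proof.
move=> le_mn [ys [sz pth un al]]; exists (take m ys); split.
- by rewrite size_takel // sz.
- exact: take_path.
- by move: un => /=; case/andP=> nx un; rewrite take_uniq // andbT;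
    apply: contra nx; apply: mem_take.
- by move=> y /mem_take; apply: al.
Qed.

Lemma walk_cons Z x y n :
  e x y -> y \in Z -> x \notin Z -> walk Z y n -> walk Z x n.+1.
Proof.
move=> exy Zy nZx [ys [sz pth un al]]; exists (y :: ys); split=> //=.
- by rewrite sz.
- by rewrite exy.
- move: un => /= ->; rewrite andbT; apply: contra nZx.
  by rewrite inE => /predU1P[->//|/al].
- by move=> z; rewrite inE => /predU1P[->//|/al].
Qed.

Lemma gallai_roy W n : ~ colourable_on W n ->
  exists2 x, x \in W & walk W x n.
Proof.
move=> nW; have [//|Z sWZ|lv [ok wlk]] := @levels W W.
  by rewrite properE sWZ andbF.
have [[x Wx le_n]|no] := pselect (exists2 x, x \in W & n <= lv x).
  have [i Wi [ys [sz pth _ un al]]] := wlk x Wx; exists i => //.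
  apply: (walk_leq le_n); exists ys; split=> // y ys_y.
  by apply: al; rewrite inE ys_y orbT.
case: nW; exists lv; split=> // x Wx; rewrite ltnNge; apply/negP => le_n.
by apply: no; exists x.
Qed.

(** * Strong subdigraphs and absorbing sets *)

(** Strong connectivity of the induced subdigraph, in terms of cuts: this is the
    form that [levels] needs, and it is directly what minimality provides in
    [sink_strong]. *)
Definition strong C := forall Z, Z != set0 -> Z \proper C ->
  exists z x, [/\ z \in Z, x \in C :\: Z & e z x].

Definition strong_colourable p S :=
  forall C, C \subset S -> strong C -> colourable_on C p.

Lemma strong_colourableS p S S' :
  S \subset S' -> strong_colourable p S' -> strong_colourable p S.
Proof. by move=> sS pS C sC; apply: pS; apply: subset_trans sS. Qed.

Lemma strong_levels C x : strong C -> x \in C ->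
  exists lv : V -> nat, {in C &, forall y z, e y z -> lv y != lv z} /\
    {in C, forall y, exists ys, [/\ size ys = lv y, path e x ys, last x ys = y,
      uniq (x :: ys) & {subset x :: ys <= C}]}.
Proof.
move=> sC Cx; have [||lv [ok wlk]] := @levels C [set x].
- by rewrite sub1set.
- move=> Z; rewrite sub1set => Zx pZ; apply: sC => //.
  by apply/set0Pn; exists x.
exists lv; split=> // y Cy; have [i] := wlk y Cy.
by rewrite inE => /eqP->.
Qed.

(** Adding [v] to a maximal [S] creates a strong set through [v] which is not
    [p]-colourable, so that the levels seen from [v] in it go up to [p]. *)
Lemma maximal_strong_colourable p W : exists S, [/\ S \subset W, strong_colourable p S &
  forall v, v \in W :\: S -> walk S v p].
Proof.
pose P S := `[< S \subset W /\ strong_colourable p S >].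
have P0 : P set0.
  apply/asboolP; split=> [|C]; first exact: sub0set.
  rewrite subset0 => /eqP-> _; exists (fun=> 0).
  by split=> [x|x y]; rewrite inE.
have [S /maxsetP[/asboolP[sSW pS] maxS] _] := maxset_exists P0.
exists S; split=> // v; rewrite inE => /andP[nSv Wv].
have [C [sC strC nC]] : exists C, [/\ C \subset v |: S, strong C & ~ colourable_on C p].
  apply: contrapT => no; have : P (v |: S).
    apply/asboolP; split=> [|C sC strC]; first by rewrite subUset sub1set Wv.
    by apply: contrapT => nC; apply: no; exists C.
  by move/maxS/(_ (subsetU1 _ _))=> ES; rewrite -ES setU11 in nSv.
have Cv : v \in C.
  apply/negPn/negP => nCv; apply: nC; apply: pS => //.
  apply/subsetP => x Cx; have:= subsetP sC x Cx; rewrite !inE.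
  by case/predU1P=> // xv; rewrite -xv Cx in nCv.
have [lv [ok wlk]] := strong_levels strC Cv.
have [[x Cx le_p]|no] := pselect (exists2 x, x \in C & p <= lv x).
  have [ys [sz pth _ un al]] := wlk x Cx.
  apply: (walk_leq le_p); exists ys; split=> // y ys_y.
  have := subsetP sC y; rewrite al ?inE ?ys_y ?orbT // => /(_ isT)/predU1P[yv|//].
  by move: un; rewrite /= -yv ys_y.
case: nC; exists lv; split=> // x Cx; rewrite ltnNge; apply/negP => le_p.
by apply: no; exists x.
Qed.

(** A minimal nonempty subset that no arc leaves is strong. *)
Lemma sink_strong R : R != set0 -> exists C,
  [/\ C \subset R, C != set0, strong C &
      {in C & R :\: C, forall x y, ~~ e x y}].
Proof.
pose closed Z := [&& Z != set0, Z \subset R &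
  [forall x in Z, forall y in R :\: Z, ~~ e x y]].
move=> R0; have : closed R.
  rewrite /closed R0 subxx; apply/forall_inP => x _; apply/forall_inP => y.
  by rewrite setDv inE.
case/minset_exists=> C /minsetP[/and3P[C0 sCR /forall_inP cC] minC] _.
exists C; split=> // [Z Z0 pZ|x y Cx Ry]; last by move/forall_inP: (cC x Cx); apply.
apply: contrapT => no; move: (pZ); rewrite properEneq => /andP[/eqP nZC sZC].
apply: nZC; apply: minC => //; rewrite /closed Z0 (subset_trans sZC) //=.
apply/forall_inP => x Zx; apply/forall_inP => y; rewrite inE => /andP[nZy Ry].
apply/negP => exy; have Cx := subsetP sZC x Zx.
have [Cy|nCy] := boolP (y \in C); first by apply: no; exists x, y; rewrite !inE nZy.
by move/forall_inP/(_ y): (cC x Cx); rewrite inE nCy Ry exy => /(_ isT).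
Qed.

(** The step that adds a strong block [C] to [K].  In both sets, colour [i]
    promises a path with [min Q i] arcs, and a vertex whose out-neighbour in [K] has
    colour at least [Q] is not in [C].  If all vertices of [C] start paths with
    [Q] arcs, the colours from [Q] on keep every promise.  Otherwise let [m] be
    the largest length reached from all vertices of [C], and let [y] have
    no longer path.  A vertex [x] at level [i] seen from [y] gets colour [m - i].
    If [x] had an out-neighbour [z] in [K] of at least that colour, one could
    walk from [y] to [x], on to [z] and along the path promised by [z],
    which is longer than [m]. *)
Lemma colour_block p Q K C (col : V -> nat) :
    strong C -> colourable_on C p -> [disjoint C & K] ->
    {in K, forall z, walk K z (minn Q (col z))} ->
    {in C & K, forall x z, e x z -> col z < Q} ->
  exists c : V -> nat, [/\ {in C, forall x, c x < Q + p},
    {in C &, forall x y, e x y -> c x != c y},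
    {in C & K, forall x z, e x z -> col z < c x} &
    {in C, forall x, walk (C :|: K) x (minn Q (c x))}].
Proof.
move=> sC pC dCK wK lowK.
have [wQ|nwQ] := pselect {in C, forall x, walk (C :|: K) x Q}.
  have [c [c_lt c_ok]] := pC; exists (fun x => Q + c x); split=> [x|x y|x z|x] Cx.
  - by rewrite ltn_add2l c_lt.
  - by move=> Cy exy; rewrite eqn_add2l c_ok.
  - by move=> Kz /(lowK x z Cx Kz)/leq_trans; apply; apply: leq_addr.
  - by rewrite (minn_idPl (leq_addr _ _)); apply: wQ.
have [m [lt_mQ wm [y Cy nwy]]] : exists m, [/\ m < Q,
    {in C, forall x, walk (C :|: K) x m} &
    exists2 y, y \in C & ~ walk (C :|: K) y m.+1].
  apply: contrapT => no; apply: nwQ.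
  elim: {-2}Q (leqnn Q) => [_ x _|m IH lt_mQ x Cx]; first exact: walk0.
  apply: contrapT => nwx; apply: no; exists m.
  by split=> //; [apply: IH; apply: ltnW|exists x].
have [lv [ok wlk]] := strong_levels sC Cy.
have lv_le : {in C, forall x, lv x <= m}.
  move=> x /wlk[ys [sz pth _ un al]]; rewrite leqNgt; apply/negP => lt_m.
  apply: nwy; apply: (walk_leq lt_m); exists ys; split=> // z ys_z.
  by rewrite inE al // inE ys_z orbT.
exists (fun x => m - lv x); split.
- by move=> x Cx; lia.
- move=> x z Cx Cz exz; have := ok _ _ Cx Cz exz.
  by have := lv_le _ Cx; have := lv_le _ Cz; lia.
- move=> x z Cx Kz exz; rewrite ltnNge; apply/negP => le_m; apply: nwy.
  have [ys [sz pth lst un al]] := wlk x Cx.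
  have [zs [sz' pth' un' al']] := wK z Kz.
  have lt_cQ := lowK x z Cx Kz exz.
  suff : walk (C :|: K) y (lv x + (col z).+1).
    by apply: walk_leq; rewrite addnS ltnS -leq_subLR.
  exists (ys ++ z :: zs); split.
  + by rewrite size_cat /= sz sz' (minn_idPr (ltnW lt_cQ)).
  + by rewrite cat_path pth lst /= exz.
  + rewrite -cat_cons cat_uniq un un' andbT; apply/hasPn => u.
    rewrite inE => zs_u; apply/negP => /al Cu.
    have: u \in K by case/predU1P: zs_u => [->//|/al'].
    by rewrite (disjointFr dCK Cu).
  + move=> u; rewrite mem_cat !inE => /or3P[ys_u|/eqP->|/al'->].
    * by rewrite al // inE ys_u orbT.
    * by rewrite Kz orbT.
    * by rewrite orbT.
- move=> x Cx; apply: walk_leq (wm x Cx); lia.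
Qed.

(** [K] is built from the sinks upwards: strong blocks without outgoing arcs to
    the remaining part [R] are added to [K], and a vertex is discarded as soon
    as it has an out-neighbour in [K] of colour at least [Q], since it then
    starts a path with [Q + 1] arcs into [K]. *)
Lemma absorbing p Q W : strong_colourable p W -> exists K,
  [/\ K \subset W, colourable_on K (Q + p) & {in W :\: K, forall v, walk K v Q.+1}].
Proof.
move=> pW.
suff step n K (R : {set V}) (col : V -> nat) : #|R| < n -> K \subset W -> R \subset W ->
    [disjoint R & K] -> {in K, forall x, col x < Q + p} ->
    {in K &, forall x y, e x y -> col x != col y} ->
    {in K & R, forall x y, ~~ e x y} ->
    {in K, forall z, walk K z (minn Q (col z))} ->
    {in R & K, forall x z, e x z -> col z < Q} ->
    (forall v, v \in W -> v \notin K -> v \notin R -> walk K v Q.+1) ->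
    exists K, [/\ K \subset W, colourable_on K (Q + p) &
                  {in W :\: K, forall v, walk K v Q.+1}].
  apply: (step #|W|.+1 set0 W (fun=> 0)) => //.
  - exact: sub0set.
  - by rewrite -setI_eq0 setI0.
  - by move=> x; rewrite inE.
  - by move=> x y; rewrite inE.
  - by move=> x y; rewrite inE.
  - by move=> x; rewrite inE.
  - by move=> x y _; rewrite inE.
  - by move=> v ->.
elim: n K R col => // n IH K R col ltRn sKW sRW dRK clt cok KR wK low done'.
have [R0|R0] := eqVneq R set0.
  exists K; split=> // [|v]; first by exists col.
  by rewrite inE => /andP[nKv Wv]; apply: done' => //; rewrite R0 inE.
have [C [sCR C0 sC CR]] := sink_strong R0.
have sCW := subset_trans sCR sRW.
have dCK : [disjoint C & K] by apply: disjointWl dRK.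
have lowC : {in C & K, forall x z, e x z -> col z < Q}.
  by move=> x z /(subsetP sCR) Rx; apply: low.
have [c [c_lt c_ok cC cw]] := colour_block sC (pW C sCW sC) dCK wK lowC.
pose col' x := if x \in C then c x else col x.
have colK x : x \in K -> col' x = col x by rewrite /col' => Kx; rewrite (disjointFl dCK).
have colC x : x \in C -> col' x = c x by rewrite /col' => ->.
pose R' := [set x in R :\: C | [forall z in C, e x z ==> (c z < Q)]].
apply: (IH (C :|: K) R' col').
- have [x0 Cx0] := set0Pn _ C0.
  apply: leq_trans (_ : #|R| <= n) => //; apply: proper_card.
  apply/properP; split; first by apply/subsetP => x; rewrite !inE => /andP[/andP[]].
  by exists x0; [apply: subsetP sCR _ _|rewrite !inE Cx0].
- by rewrite subUset sCW.
- by apply: subset_trans sRW; apply/subsetP => x; rewrite !inE => /andP[/andP[]].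
- rewrite -setI_eq0; apply/eqP/setP => x; rewrite !inE.
  apply/negP => /andP[/andP[/andP[nCx Rx] _]]; rewrite (negPf nCx) /= => Kx.
  by rewrite (disjointFr dRK Rx) in Kx.
- move=> x; rewrite inE => /orP[Cx|Kx]; first by rewrite colC // c_lt.
  by rewrite colK // clt.
- move=> x y; rewrite !inE => /orP[Cx|Kx] /orP[Cy|Ky] exy.
  + by rewrite !colC // c_ok.
  + by rewrite (colC x) // (colK y) // neq_ltn cC ?orbT.
  + by rewrite (negPf (KR x y Kx (subsetP sCR y Cy))) in exy.
  + by rewrite !colK // cok.
- move=> x y; rewrite !inE => /orP[Cx|Kx] /andP[/andP[nCy Ry] _].
    by apply: CR; rewrite ?inE ?nCy.
  exact: KR.
- move=> x; rewrite inE => /orP[Cx|Kx]; first by rewrite colC //; apply: cw.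
  by rewrite colK //; apply: walkS (wK x Kx); apply: subsetUr.
- move=> x z; rewrite !inE => /andP[/andP[nCx Rx] /forall_inP lx] /orP[Cz|Kz] exz.
    by rewrite colC //; apply: (implyP (lx z Cz)).
  by rewrite colK //; apply: low exz.
- move=> v Wv; rewrite !inE negb_or => /andP[nCv nKv].
  have [Rv|nRv] := boolP (v \in R); last first.
    by move=> _; apply: walkS (done' v Wv nKv nRv); apply: subsetUr.
  rewrite nCv /= => /forall_inPn[z Cz]; rewrite negb_imply -leqNgt => /andP[evz le_Q].
  apply: (walk_cons evz); rewrite ?inE ?Cz ?(negPf nCv) //.
  by have := cw z Cz; rewrite (minn_idPl le_Q).
Qed.

(** * Degeneracy *)

(** Some vertex has in-degree less than [k] as well, hence at most
    [2 * k - 2] neighbours, and is coloured last. *)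
Lemma colourable_on_outdeg W k : 0 < k ->
  {in W, forall x, #|[set y in W | e x y]| < k} -> colourable_on W (2 * k - 1).
Proof.
move=> k0; have [n] := ubnP #|W|; elim: n W => // n IH W ltWn out.
have [->|W0] := eqVneq W set0; first by exists (fun=> 0); split=> [x|x y]; rewrite inE.
have [v Wv inv] : exists2 v, v \in W & #|[set y in W | e y v]| < k.
  apply: contrapT => no.
  have ge_k : \sum_(v in W) k <= \sum_(v in W) #|[set y in W | e y v]|.
    apply: leq_sum => v Wv; rewrite leqNgt; apply/negP => lt_k.
    by apply: no; exists v.
  have lt_k : \sum_(v in W) #|[set y in W | e v y]| <= \sum_(v in W) k.-1.
    by apply: leq_sum => v /out; lia.
  have Ed : \sum_(v in W) #|[set y in W | e y v]| =
            \sum_(v in W) #|[set y in W | e v y]|.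
    have sumE (a : rel V) : \sum_(v in W) #|[set y in W | a v y]| =
        \sum_(v in W) \sum_(y in W) (a v y : nat).
      apply: eq_bigr => v _; rewrite -sum1_card big_mkcond [RHS]big_mkcond /=.
      by apply: eq_bigr => y _; rewrite inE; case: (y \in W); case: (a v y).
    by rewrite (sumE (fun v y => e y v)) (sumE e) exchange_big.
  move: ge_k lt_k; rewrite Ed !sum_nat_const; move: W0; rewrite -card_gt0.
  by move: (\sum_(v in W) _) => s *; nia.
have [|x|c [c_lt c_ok]] := IH (W :\ v).
- by have := cardsD1 v W; rewrite Wv; lia.
- rewrite inE => /andP[_ /out]; apply: leq_ltn_trans; apply: subset_leq_card.
  by apply/subsetP => y; rewrite !inE => /andP[/andP[_ ->]].
pose N := [set y in W | e v y] :|: [set y in W | e y v].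
have [j lt_j nj] : exists2 j, j < 2 * k - 1 & j \notin [seq c y | y in N].
  apply: contrapT => no.
  have /(uniq_leq_size (iota_uniq 0 (2 * k - 1))) :
      {subset iota 0 (2 * k - 1) <= [seq c y | y in N]}.
    move=> j; rewrite mem_iota add0n /= => lt_j.
    by apply: contrapT => /negP nj; apply: no; exists j.
  rewrite size_iota size_image; have := out v Wv.
  have [+ _] := leq_card_setU [set y in W | e v y] [set y in W | e y v].
  by rewrite -/N; move: inv k0; lia.
exists (fun x => if x == v then j else c x); split=> [x Wx|x y Wx Wy exy].
  by case: eqVneq => // xv; apply: c_lt; rewrite !inE xv.
move: exy; case: (eqVneq x v) => [->|xv]; case: (eqVneq y v) => [->|yv] exy.
- by rewrite e_irr in exy.
- by apply: contraNneq nj => ->; apply: image_f; rewrite !inE Wy exy.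
- by apply: contraNneq nj => <-; apply: image_f; rewrite !inE Wx exy orbT.
- by apply: c_ok; rewrite ?inE ?xv ?yv.
Qed.

(** * Embedding rooted trees *)

(** An out-arborescence is given by its root [r] and the map [par] from a vertex to
    its parent; [dep] makes all ancestor sequences reach the root. *)
Variables (A : finType) (r : A) (par : A -> A) (dep : A -> nat).
Hypothesis dep_par : forall v, v != r -> dep (par v) < dep v.
Implicit Types (X Y : {set A}) (u v w : A) (b : seq A) (f : A -> V).

Definition closed X := forall v, v \in X -> v != r -> par v \in X.

Definition embeds X W f := [/\ {in X, forall v, f v \in W}, {in X &, injective f} &
  forall v, v \in X -> v != r -> e (f (par v)) (f v)].

(** The class [P] of vertex sets is either everything or the sets whose strong
    subsets are [p]-colourable. *)
Definition hosts (P : {set V} -> Prop) X n :=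
  forall W, P W -> ~ colourable_on W n -> exists f, embeds X W f.

Lemma hosts_leq P X m n : m <= n -> hosts P X m -> hosts P X n.
Proof. by move=> le_mn hX W PW nW; apply: hX => // /(colourable_on_leq le_mn). Qed.

Lemma embeds_add1 Y W f v y : closed Y -> embeds Y W f -> v \notin Y -> y \in W ->
    {in Y, forall u, f u != y} -> (v != r -> par v \in Y /\ e (f (par v)) y) ->
  embeds (v |: Y) W (fun u => if u == v then y else f u).
Proof.
move=> cY [fW fI fe] nYv Wy fy pv.
have neq u : u \in Y -> (u == v) = false.
  by move=> Yu; apply/negP => /eqP uv; rewrite -uv Yu in nYv.
split=> [u|u u'|u].
- by rewrite !inE => /predU1P[->|Yu]; rewrite ?eqxx ?(neq u) ?fW.
- rewrite !inE => /predU1P[->|Yu] /predU1P[->|Yu'] //; rewrite ?eqxx ?neq //.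
  + by move/eqP; rewrite eq_sym (negPf (fy u' Yu')).
  + by move/eqP; rewrite (negPf (fy u Yu)).
  + exact: fI.
- rewrite !inE => /predU1P[->|Yu] nr.
    by have [Yp ep] := pv nr; rewrite eqxx neq.
  by rewrite (neq u) // (neq (par u)) ?fe // cY.
Qed.

Definition chain w b := path [rel u v | (par v == u) && (v != r)] w b.

Lemma closed_add1 Y v : closed Y -> (v != r -> par v \in Y) -> closed (v |: Y).
Proof.
move=> cY pv u; rewrite !inE => /predU1P[->|Yu] nr; first by rewrite pv ?orbT.
by rewrite cY ?orbT.
Qed.

Lemma closed_chain Y w b :
  closed Y -> w \in Y -> chain w b -> closed (Y :|: [set x in b]).
Proof.
elim: b Y w => [|v b IH] Y w cY Yw /=.
  by rewrite (_ : [set x in [::]] = set0) ?setU0 //; apply/setP => x; rewrite !inE.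
case/andP=> /andP[/eqP pv nr] cb.
rewrite (_ : _ :|: _ = (v |: Y) :|: [set x in b]).
  by apply: (IH _ v); rewrite ?setU11 //; apply: closed_add1 => // _; rewrite pv.
by apply/setP => x; rewrite !inE orbCA orbA.
Qed.

Lemma embeds_chain Y W f w b ys : closed Y -> embeds Y W f -> w \in Y -> chain w b ->
    uniq b -> {in b, forall u, u \notin Y} -> size ys = size b ->
    path e (f w) ys -> uniq ys -> {subset ys <= W} ->
    {in ys & Y, forall y u, f u != y} ->
  exists g, embeds (Y :|: [set x in b]) W g.
Proof.
elim: b Y f w ys => [|v b IH] Y f w [|y ys] cY fY Yw //=.
  by exists f; rewrite (_ : [set x in [::]] = set0) ?setU0.
case/andP=> /andP[/eqP pv nr] cb /andP[nbv ub] bY [sz] /andP[ey pth].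
case/andP=> nyy uy sysW ysY.
rewrite (_ : _ :|: _ = (v |: Y) :|: [set x in b]); last first.
  by apply/setP => x; rewrite !inE orbCA orbA.
have nYv : v \notin Y by apply: bY; rewrite mem_head.
apply: (IH _ (fun u => if u == v then y else f u) v ys) => //.
- by apply: closed_add1 => // _; rewrite pv.
- apply: embeds_add1 => //; first by apply: sysW; rewrite mem_head.
    by move=> u Yu; apply: ysY; rewrite ?mem_head.
  by rewrite pv.
- exact: setU11.
- move=> u bu; rewrite !inE negb_or bY ?inE ?bu ?orbT // andbT.
  by apply: contraNneq nbv => <-.
- by rewrite eqxx.
- by move=> z zs; apply: sysW; rewrite inE zs orbT.
- move=> z u zs; rewrite !inE; case: (eqVneq u v) => [_ _|_ /= Yu].
    by apply: contraNneq nyy => ->.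
  by apply: ysY; rewrite ?inE ?zs ?orbT.
Qed.

(** Gluing a path: [Y] is embedded outside of the absorbing set [S] and the path
    [b] inside of it, so that they are disjoint; the only alternative is
    that [S] needs many colours and contains the whole tree. *)
Lemma hosts_chain (P : {set V} -> Prop) w b Y n m :
    (forall S W, S \subset W -> P W -> P S) ->
    closed Y -> w \in Y -> chain w b -> uniq b -> {in b, forall u, u \notin Y} ->
    (forall W, P W -> exists S, [/\ S \subset W,
       ~ colourable_on S m -> exists f, embeds (Y :|: [set x in b]) S f &
       {in W :\: S, forall x, walk S x (size b)}]) ->
  hosts P Y n -> hosts P (Y :|: [set x in b]) (n + m).
Proof.
move=> PS cY Yw cb ub bY absorb hY W PW nW.
have [S [sSW hS wS]] := absorb W PW.
have [cS|/hS[f [fS fI fe]]] := pselect (colourable_on S m); last first.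
  by exists f; split=> // v Xv; apply: subsetP sSW _ (fS v Xv).
have nWS : ~ colourable_on (W :\: S) n.
  move=> cWS; apply: nW; rewrite -(setID W S) setUC.
  by apply: colourable_onU cWS _; apply: colourable_onS cS; apply: subsetIr.
have [f fY] := hY _ (PS _ _ (subsetDl _ _) PW) nWS.
have [fW fI fe] := fY; have [ys [sz pth /= /andP[_ uy] al]] := wS _ (fW w Yw).
apply: (embeds_chain (f := f) (ys := ys) cY _ Yw cb ub bY) => //; first split=> //.
- by move=> v /fW; rewrite inE => /andP[].
- by move=> y /al/(subsetP sSW).
- move=> y u /al Sy /fW; rewrite inE => /andP[nS _].
  by apply: contraNneq nS => ->.
Qed.

(** The parameter bounds the number of leaves.  The first path starts at the root
    and is separate from the others, because the Gallai-Roy theorem provides it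
    without the loss of [p] colours incurred by each further path. *)
Inductive branched : nat -> {set A} -> Prop :=
| Branched1 b : chain r b -> uniq (r :: b) -> branched 1 (r |: [set x in b])
| BranchedS l Y w b : branched l Y -> w \in Y -> chain w b -> uniq b ->
    {in b, forall u, u \notin Y} -> branched l.+1 (Y :|: [set x in b]).

Lemma closed_root : closed [set r].
Proof. by move=> v; rewrite inE => ->. Qed.

Lemma branched_closed l X : branched l X -> closed X.
Proof.
elim=> [b cb _|{}l Y w b _ cY Yw cb _ _]; last exact: closed_chain cb.
by apply: closed_chain cb; [apply: closed_root|rewrite inE].
Qed.

Lemma card_setU_chain Y b : uniq b -> {in b, forall u, u \notin Y} ->
  #|Y :|: [set x in b]| = #|Y| + size b.
Proof.
move=> ub bY; rewrite cardsU (_ : Y :&: _ = set0).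
  by rewrite cards0 subn0; congr (_ + _); rewrite -(card_uniqP ub) cardsE.
by apply/setP => x; rewrite !inE; apply/negP => /andP[Yx /bY]; rewrite Yx.
Qed.

Lemma hosts_path P b : chain r b -> uniq (r :: b) ->
  hosts P (r |: [set x in b]) (#|r |: [set x in b]| - 1).
Proof.
move=> cb /= /andP[nrb ub] W _; have br : {in b, forall u, u \notin [set r]}.
  by move=> u bu; rewrite inE; apply: contraNneq nrb => <-.
rewrite card_setU_chain // cards1 addKn => /gallai_roy[x Wx].
case=> ys [sz pth /= /andP[nx uy] al].
apply: (embeds_chain (f := fun=> x) (w := r) (ys := ys)) => //.
- exact: closed_root.
- split=> // [u v|v]; first by rewrite !inE => /eqP-> /eqP->.
  by rewrite inE => ->.
- by rewrite inE.
- by move=> y u ys_y _; apply: contraNneq nx => ->.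
Qed.

(** Each path after the first costs its own size plus [p], by [absorbing]. *)
Lemma hosts_strong_colourable p l X : branched l X ->
  hosts (strong_colourable p) X (#|X| - 1 + (l - 1) * p).
Proof.
elim=> [b cb ub|{}l Y w b bY IH Yw cb ub nYb].
  by rewrite addn0; apply: hosts_path.
have cY := branched_closed bY.
have Y0 : 0 < #|Y| by apply/card_gt0P; exists w.
have l0 : 0 < l by case: bY.
rewrite card_setU_chain //.
apply: (hosts_leq (m := (#|Y| - 1 + (l - 1) * p) + (size b + p))); first by nia.
apply: hosts_chain Yw cb ub nYb _ IH => // [S W|W pW]; first exact: strong_colourableS.
case: (size b) => [|Q].
  exists set0; split; rewrite ?sub0set //; last by move=> v _; apply: walk0.
  by case; exists (fun=> 0); split=> [x|x y]; rewrite inE.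
have [K [sKW cK wK]] := absorbing Q pW; exists K; split=> //.
by case; apply: colourable_on_leq cK; lia.
Qed.

(** With [p] the size of the last path, the cost [l * #|Y| - 1] for [Y] and the
    cost [#|X| - 1 + l * p] for [S] add up to less than [l.+1 * #|X|],
    since [#|X| = #|Y| + p]. *)
Lemma hosts_branched l X : branched l X -> hosts (fun=> True) X (l * #|X| - 1).
Proof.
elim=> [b cb ub|{}l Y w b bY IH Yw cb ub nYb].
  by rewrite mul1n; apply: hosts_path.
have cY := branched_closed bY.
have Y0 : 0 < #|Y| by apply/card_gt0P; exists w.
have l0 : 0 < l by case: bY.
have hX := hosts_strong_colourable (p := size b) (BranchedS bY Yw cb ub nYb).
apply: (hosts_leq (m := (l * #|Y| - 1) +
    (#|Y :|: [set x in b]| - 1 + (l.+1 - 1) * size b))).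
  by rewrite card_setU_chain //; nia.
apply: hosts_chain Yw cb ub nYb _ IH => // W _.
have [S [sSW pS wS]] := maximal_strong_colourable (size b) W; exists S; split=> //.
exact: hX.
Qed.

Definition leaves X := [set v in X | [forall u in X, (u != r) ==> (par u != v)]].

Lemma leavesP X v : reflect
  (v \in X /\ forall u, u \in X -> u != r -> par u != v) (v \in leaves X).
Proof.
rewrite inE; apply: (iffP andP) => -[Xv]; split=> //.
  by move=> u Xu; apply/implyP; apply: (forall_inP b).
by apply/forall_inP => u Xu; apply/implyP; apply: b.
Qed.

Lemma root_in_closed X : closed X -> X != set0 -> r \in X.
Proof.
move=> cX /set0Pn[v Xv]; have [n] := ubnP (dep v).
elim: n v Xv => // n IH v Xv lt_n; case: (eqVneq v r) => [<-//|nr].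
by apply: (IH (par v)); [apply: cX|have := dep_par nr; lia].
Qed.

(** A deepest vertex of [X] outside of [Y] has no child in [Y], as [Y] is closed,
    and no child in [X :\: Y]. *)
Lemma leaf_outside X Y : closed Y -> X :\: Y != set0 ->
  exists2 v, v \in leaves X & v \notin Y.
Proof.
move=> cY /set0Pn[v0 v0P]; have [v /setDP[Xv nYv] vmax] := arg_maxnP dep v0P.
have {}vmax u : u \in X :\: Y -> dep u <= dep v := vmax u.
exists v => //; apply/leavesP; split=> // u Xu nr.
apply/negP => /eqP pu; have := dep_par nr; rewrite pu ltnNge vmax // inE Xu andbT.
by apply: contra nYv => Yu; rewrite -pu; apply: cY.
Qed.

Lemma chain_to X Y v : closed X -> closed Y -> r \in Y -> v \in X ->
  exists w b, [/\ w \in Y, chain w b, last w b = v, uniq b &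
    {in b, forall u, [/\ u \in X, u \notin Y & dep u <= dep v]}].
Proof.
move=> cX cY Yr; have [n] := ubnP (dep v); elim: n v => // n IH v lt_n Xv.
have [Yv|nYv] := boolP (v \in Y); first by exists v, [::].
have nr : v != r by apply: contraNneq nYv => ->.
have lt := dep_par nr.
have [||w [b [Yw cb lb ub bP]]] := IH (par v); [lia|exact: cX|].
exists w, (rcons b v); split=> //.
- by rewrite /chain rcons_path -/(chain w b) cb /= lb eqxx.
- by rewrite last_rcons.
- by rewrite rcons_uniq ub andbT; apply/negP => /bP[_ _]; lia.
- move=> u; rewrite mem_rcons inE => /predU1P[->//|/bP[? ? le_u]].
  by split=> //; apply: leq_trans le_u (ltnW lt).
Qed.

Lemma branched_cover X v s : closed X -> {subset v :: s <= X} ->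
  exists Y, [/\ branched (size s).+1 Y, Y \subset X & {subset v :: s <= Y}].
Proof.
move=> cX; have cr := closed_root; elim: s => [|u s IH] sX.
  have Xv : v \in X by apply: sX; rewrite mem_head.
  have Xr : r \in X by apply: root_in_closed => //; apply/set0Pn; exists v.
  have [w [b [Yw cb lb ub bP]]] := chain_to cX cr (set11 r) Xv.
  move: Yw; rewrite inE => /eqP Ew; rewrite Ew in cb lb.
  exists (r |: [set x in b]); split.
  - apply: Branched1 => //=; rewrite ub andbT.
    by apply/negP => /bP[_]; rewrite inE eqxx.
  - by apply/subsetP => x; rewrite !inE => /predU1P[->//|/bP[]].
  - by move=> x; rewrite inE => /eqP->; rewrite !inE -lb -in_cons mem_last.
have [|Y [bY sYX sY]] := IH.
  by move=> x; rewrite inE => H; apply: sX; rewrite !inE orbCA H orbT.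
have cY := branched_closed bY.
have Yr : r \in Y.
  by apply: root_in_closed => //; apply/set0Pn; exists v; apply: sY; rewrite mem_head.
have Xu : u \in X by apply: sX; rewrite !inE eqxx orbT.
have [w [b [Yw cb lb ub bP]]] := chain_to cX cY Yr Xu.
exists (Y :|: [set x in b]); split.
- by apply: BranchedS bY Yw cb ub _ => x /bP[].
- by rewrite subUset sYX; apply/subsetP => x; rewrite inE => /bP[].
- move=> x; rewrite !inE orbCA => /orP[/eqP->|H]; last by rewrite sY.
  have := mem_last w b; rewrite lb inE => /predU1P[->|->]; last by rewrite orbT.
  by rewrite Yw.
Qed.

Lemma branched_leaves X : closed X -> X != set0 -> branched #|leaves X| X.
Proof.
move=> cX X0; have c0 : closed set0 by move=> u; rewrite inE.
have [|v Lv _] := @leaf_outside X _ c0; first by rewrite setD0.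
have := cardsD1 v (leaves X); rewrite Lv add1n => ->.
have [|Y [bY sYX sY]] := @branched_cover X v (enum (leaves X :\ v)) cX.
  move=> u; rewrite inE mem_enum => /predU1P[->|]; first by case/leavesP: Lv.
  by rewrite inE => /andP[_ /leavesP[]].
rewrite -cardE in bY; suff EY : Y = X by rewrite EY in bY.
apply/eqP; rewrite eqEsubset sYX -setD_eq0; apply/negPn/negP.
case/(leaf_outside (branched_closed bY)) => u Lu /negP[]; apply: sY.
by rewrite inE mem_enum in_setD1 Lu andbT orbN.
Qed.

Lemma closed_leaves X : closed X -> closed (X :\: leaves X).
Proof.
move=> cX v; rewrite inE => /andP[nLv Xv] nr; rewrite inE cX // andbT.
by apply/negP => /leavesP[_ /(_ v Xv nr)]; rewrite eqxx.
Qed.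

(** The tree without its leaves is embedded among the vertices [B] of out-degree at
    least [#|X|]; then any partial embedding extends by a further leaf. *)
Lemma hosts_leaves X n : closed X -> X != set0 ->
  hosts (fun=> True) (X :\: leaves X) n ->
  hosts (fun=> True) X (n + (2 * #|X| - 1)).
Proof.
move=> cX X0 hX W _ nW; pose N x := [set y in W | e x y].
have k0 : 0 < #|X| by rewrite card_gt0.
pose B := [set x in W | #|X| <= #|N x|].
have nB : ~ colourable_on B n.
  move=> cB; apply: nW; rewrite -(setID W B); apply: colourable_onU.
    by apply: colourable_onS cB; apply: subsetIr.
  apply: colourable_on_outdeg => // x; rewrite !inE => /andP[nBx Wx].
  move: nBx; rewrite Wx -ltnNge; apply: leq_ltn_trans; apply: subset_leq_card.
  by apply/subsetP => y; rewrite !inE => /andP[/andP[_ ->]].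
have [x0 Bx0] : exists x0, x0 \in B.
  apply/set0Pn/eqP => B0; apply: nB; exists (fun=> 0).
  by rewrite B0; split=> [x|x y]; rewrite inE.
have [f [fB fI fe]] := hX B I nB.
set X' := X :\: leaves X in fB fI fe hX *.
have sX'X : X' \subset X by apply: subsetDl.
have cX' : closed X' by apply: closed_leaves.
suff grow m Y g : #|X :\: Y| < m -> X' \subset Y -> Y \subset X ->
    embeds Y W g -> {in X', forall v, g v \in B} -> exists h, embeds X W h.
  apply: (grow #|X :\: X'|.+1 X' f) => //.
  by split=> // v /fB; rewrite inE => /andP[].
elim: m Y g => // m IH Y g lt_m sX'Y sYX gY gB.
have [XY|/set0Pn[v]] := eqVneq (X :\: Y) set0.
  exists g; suff -> : X = Y by []; apply/eqP.
  by rewrite eqEsubset sYX andbT -setD_eq0 XY.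
rewrite inE => /andP[nYv Xv].
have Lv : v \in leaves X.
  by apply: contraR nYv => nLv; apply: (subsetP sX'Y); rewrite inE nLv.
have parX' : {in X, forall u, u != r -> par u \in X'}.
  move=> u Xu nr; rewrite inE cX // andbT.
  by apply/negP => /leavesP[_ /(_ u Xu nr)]; rewrite eqxx.
(* Only when the root is a leaf does [v] have no image of a parent to hang from;
   any vertex of [B] serves then. *)
pose x := if v == r then x0 else g (par v).
have Bx : x \in B by rewrite /x; case: (eqVneq v r) => // nr; apply: gB; apply: parX'.
have [y Ny gy] : exists2 y, y \in N x & y \notin g @: Y.
  apply/subsetPn/negP => /subset_leq_card; have := leq_imset_card g Y.
  have : #|Y| < #|X| by apply: proper_card; apply/properP; split=> //; exists v.
  by move: Bx; rewrite inE => /andP[_]; clear; lia.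
have cY : closed Y.
  by move=> u Yu nr; apply: (subsetP sX'Y); apply: parX' => //; apply: (subsetP sYX).
move: Ny; rewrite inE => /andP[Wy exy].
apply: (IH (v |: Y) (fun u => if u == v then y else g u)).
- have := cardsD1 v (X :\: Y); rewrite !inE nYv Xv /= => Ec.
  rewrite (_ : X :\: (v |: Y) = (X :\: Y) :\ v); first by clear -lt_m Ec; lia.
  by apply/setP => u; rewrite !inE negb_or -andbA.
- exact: subset_trans sX'Y (subsetU1 _ _).
- by rewrite subUset sub1set Xv.
- apply: embeds_add1 => //.
    by move=> u Yu; apply: contraNneq gy => <-; apply: imset_f.
  move=> nr; split; first by apply: (subsetP sX'Y); apply: parX'.
  by move: exy; rewrite /x (negPf nr).
- move=> u X'u; case: eqVneq => [uv|_]; last exact: gB.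
  by move: X'u; rewrite uv inE Lv.
Qed.

End Host.

(** * From arborescences to parent maps *)

(** The parent of [v] is the vertex before [v] on a fixed shortest path from [r].
    If [u -> v] is an arc directed away from [r], then [u] lies on this path,
    and being adjacent to [v] it can only be its last but one vertex. *)
Lemma parent_of_between (T : finType) (a adj : rel T) (r : T) :
    irreflexive a -> subrel a adj -> (forall v, connect adj r v) ->
    (forall u v, a u v -> between adj r u v) ->
  exists (par : T -> T) (dep : T -> nat),
    (forall v, v != r -> dep (par v) < dep v) /\
    (forall u v, a u v -> v != r /\ u = par v).
Proof.
move=> a_irr a_adj conn btw.
pose geod v n := `[< exists p,
  [/\ path adj r p, last r p = v, uniq (r :: p) & size p = n] >].
have short v p : path adj r p -> last r p = v ->
    exists2 n, n <= size p & geod v n.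
  move=> pth lst; move: lst; case/shortenP: pth => q qth un sub lst.
  exists (size q); last by apply/asboolP; exists q.
  by move: un => /= /andP[_ un]; apply: uniq_leq_size => // x /sub.
have geod_ex v : exists n, geod v n.
  have /connectP[p pth lst] := conn v.
  by have [n _] := short v p pth (esym lst); exists n.
pose dep v := ex_minn (geod_ex v).
have dep_min v p : path adj r p -> last r p = v -> dep v <= size p.
  move=> pth lst; have [n le_n gn] := short v p pth lst; rewrite /dep.
  by case: ex_minnP => m _ /(_ n gn)/leq_trans; apply.
have pre v : exists w, v != r -> exists q, [/\ path adj r (rcons q v),
    last r q = w, uniq (r :: rcons q v) & (size q).+1 = dep v].
  have : geod v (dep v) by rewrite /dep; case: ex_minnP.
  case/asboolP=> p; case: (lastP p) => [[_ <- _ _]|q x [pth lst un sz]].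
    by exists r; rewrite eqxx.
  rewrite last_rcons in lst; rewrite lst in pth un sz.
  by exists (last r q) => _; exists q; rewrite -sz size_rcons.
have [par parP] := choice pre.
exists par, dep; split=> [v nr|u v auv].
  have [q [pth lst _ <-]] := parP v nr; rewrite ltnS.
  by apply: dep_min => //; move: pth; rewrite rcons_path => /andP[].
have nr : v != r.
  apply/eqP => Ev; have := btw u v auv [::] isT isT (esym Ev).
  by rewrite inE => /eqP Eu; have := a_irr u; rewrite {2}Eu -Ev auv.
split=> //; have [q [pth lst un sz]] := parP v nr.
have := btw u v auv _ pth un (last_rcons _ _ _).
rewrite -rcons_cons mem_rcons inE => /predU1P[Eu|q_u].
  by have := a_irr u; rewrite {2}Eu auv.
case/splitPl: q_u pth lst un sz => q1 q2 lst1.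
rewrite rcons_path cat_path -andbA => /and3P[pth1 _ _] lst _ sz.
have := @dep_min v (rcons q1 v); rewrite rcons_path pth1 lst1 last_rcons size_rcons.
rewrite (a_adj _ _ auv) -sz size_cat => /(_ isT erefl).
case: q2 lst {sz} => [|x q2] /=; last by lia.
by rewrite cats0 lst1.
Qed.

Local Open Scope ring_scope.

(** * The numerical recursion *)
Definition chi_bound (R : realType) (k : nat) : R :=
  Num.sqrt (4 / 3) * k%:R * Num.sqrt k%:R + k%:R / 2.

(** Write [a = sqrt k], [b = sqrt (k - l)] and [c = sqrt (4 / 3)].  The hypothesis
    reads [c * a + 1 / 2 < l], whence
    [b ^+ 2 < a ^+ 2 - c * a - 1 / 2 < (a - c / 2) ^+ 2].  Bounding one
    factor [b] of [b ^+ 3] by [a - c / 2] bounds the left-hand side by a polynomial in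
    [a] whose leading terms are those of the right-hand side,
    because [c ^+ 2 = 4 / 3]. *)
Lemma chi_bound_step (R : realType) (k l : nat) : (0 < k)%N -> (l <= k)%N ->
  chi_bound R k < (l * k)%:R -> chi_bound R (k - l) + (2 * k)%:R <= chi_bound R k.
Proof.
move=> k0 lk; rewrite /chi_bound !natrM natrB //.
set c := Num.sqrt (4 / 3); set a := Num.sqrt k%:R; set b := Num.sqrt _.
have cE : c ^+ 2 = 4 / 3 by apply: sqr_sqrtr; lra.
have aE : a ^+ 2 = k%:R by apply: sqr_sqrtr; apply: ler0n.
have bE : b ^+ 2 = k%:R - l%:R.
  by apply: sqr_sqrtr; rewrite subr_ge0 ler_nat.
have c0 : 0 <= c by apply: sqrtr_ge0.
have b0 : 0 <= b by apply: sqrtr_ge0.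
have a0 : 0 <= a by apply: sqrtr_ge0.
have k1 : 1 <= k%:R :> R by rewrite ler1n.
have a1 : 1 <= a by nra.
have c1 : 1 <= c by nra.
have c2 : c <= 2 by nra.
rewrite -bE -aE; rewrite -aE in bE; move: (l%:R : R) bE => t bE lt.
have lb : c * a + 1 / 2 <= t.
  have : (c * a + 1 / 2) * a ^+ 2 <= t * a ^+ 2 by lra.
  by rewrite ler_pM2r // exprn_gt0 //; lra.
have u0 : 0 <= a - c / 2 by lra.
have bu : b <= a - c / 2 by rewrite -(ler_pXn2r (n := 2)) ?nnegrE //; nra.
have b3 : c * b ^+ 2 * b <= c * b ^+ 2 * (a - c / 2).
  by apply: ler_wpM2l => //; apply: mulr_ge0 => //; apply: sqr_ge0.
have b2 : b ^+ 2 <= a ^+ 2 - c * a - 1 / 2 by lra.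
have : c * (a - c / 2) * b ^+ 2 <= c * (a - c / 2) * (a ^+ 2 - c * a - 1 / 2).
  by apply: ler_wpM2l => //; apply: mulr_ge0.
have -> : c * (a - c / 2) * (a ^+ 2 - c * a - 1 / 2) =
  c * a ^+ 3 - (c ^+ 2) * (3 / 2) * a ^+ 2 + c ^+ 2 * c / 2 * a - c * a / 2 + c ^+ 2 / 4.
  by field.
rewrite cE; nra.
Qed.

Lemma hosts_chi_bound (R : realType) (V A : finType) (e : rel V) (r : A)
    (par : A -> A) (dep : A -> nat) (X : {set A}) (n : nat) :
    irreflexive e -> (forall v, v != r -> (dep (par v) < dep v)%N) ->
    closed r par X -> chi_bound R #|X| <= n.+1%:R ->
  hosts e r par (fun=> True) X n.
Proof.
move=> e_irr dep_par; have [m] := ubnP #|X|.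
elim: m X n => // m IH X n ltXm cX le_n.
have [X0|X0] := eqVneq X set0.
  move=> W _ nW; have [x _] : exists x, x \in W.
    apply/set0Pn/eqP => W0; apply: nW; exists (fun=> 0%N).
    by rewrite W0; split=> [x|x y]; rewrite inE.
  by exists (fun=> x); rewrite X0; split=> [v|u v|v]; rewrite inE.
have k0 : (0 < #|X|)%N by rewrite card_gt0.
have brX := branched_leaves dep_par cX X0.
set l := #|leaves r par X| in brX.
have [le_lk|lt_lk] := leqP (l * #|X|)%N n.+1.
  by apply: hosts_leq (hosts_branched e_irr brX); lia.
have lX : leaves r par X \subset X by apply/subsetP => v /leavesP[].
have cardX' : #|X :\: leaves r par X| = (#|X| - l)%N.
  by rewrite cardsD (setIidPr lX).
have lk : (l <= #|X|)%N by apply: subset_leq_card.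
have := @chi_bound_step R _ _ k0 lk.
have -> : chi_bound R #|X| < (l * #|X|)%:R.
  by apply: le_lt_trans le_n _; rewrite ltr_nat.
move=> /(_ isT) step; have F0 : 0 <= chi_bound R (#|X| - l).
  by rewrite /chi_bound addr_ge0 ?mulr_ge0 ?sqrtr_ge0 ?invr_ge0 ?ler0n.
have le2 : (2 * #|X| <= n.+1)%N by rewrite -(ler_nat R); lra.
have -> : n = (n - (2 * #|X| - 1) + (2 * #|X| - 1))%N by lia.
apply: (hosts_leaves e_irr) => //; apply: IH.
- have : (0 < l)%N by case: brX.
  by rewrite cardX'; lia.
- exact: closed_leaves.
rewrite cardX'.
have -> : (n - (2 * #|X| - 1)).+1 = (n.+1 - 2 * #|X|).+1 by lia.
by rewrite -natr1 natrB //; lra.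
Qed.

Lemma embeds_of_between (R : realType) (V A : finType) (e : rel V) (a adj : rel A)
    (r : A) (n : nat) :
    irreflexive e -> irreflexive a -> subrel a adj ->
    (forall v, connect adj r v) -> (forall u v, a u v -> between adj r u v) ->
    chi_bound R #|A| <= n.+1%:R -> ~ colourable_on e setT n ->
  exists f : A -> V, injective f /\ (forall u v, a u v -> e (f u) (f v)).
Proof.
move=> e_irr a_irr a_adj conn btw le_n nV.
have [par [dep [dep_par aP]]] := parent_of_between a_irr a_adj conn btw.
have cT : closed r par setT by move=> v; rewrite !inE.
rewrite -cardsT in le_n.
have [f [_ fI fe]] := hosts_chi_bound e_irr dep_par cT le_n I nV.
exists f; split=> [u v|u v /aP[nr ->]]; first by apply: fI; rewrite inE.
by apply: fe; rewrite ?inE.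
Qed.

Lemma colourable_of_on (D : digraph) (e : rel D) (n : nat) :
  (forall u v, adjacent u v -> e u v || e v u) ->
  colourable_on e setT n -> colourable D n.
Proof.
move=> eD [c [c_lt c_ok]]; apply/existsP.
exists [ffun u => Ordinal (c_lt u (in_setT u))].
apply/forallP => u; apply/forallP => v; apply/implyP => /eD.
rewrite !ffunE -val_eqE /= => /orP[euv|evu]; first by apply: c_ok; rewrite ?inE.
by rewrite eq_sym; apply: c_ok; rewrite ?inE.
Qed.

Theorem theorem12 (R : realType) (k : nat) (hk : (1 <= k)%N) (A : digraph)
    (hA : arborescence A) (hcard : #|A| = k) :
  universal (Num.sqrt (4 / 3) * k%:R * Num.sqrt k%:R + k%:R / 2 : R) A.
Proof.
move=> D; rewrite -[X in X <= _]/(chi_bound R k) -hcard => le_chi.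
have F0 : 0 < chi_bound R #|A|.
  rewrite /chi_bound ltr_wpDl ?mulr_ge0 ?sqrtr_ge0 ?ler0n // divr_gt0 //.
  by rewrite ltr0n hcard.
have chi0 : (0 < chromatic_number D)%N.
  by rewrite -(ltr_nat R); apply: lt_le_trans le_chi.
have n_col (e : rel D) : (forall u v, adjacent u v -> e u v || e v u) ->
    ~ colourable_on e setT (chromatic_number D).-1.
  move=> eD /(colourable_of_on eD) cD.
  suff : (chromatic_number D <= (chromatic_number D).-1)%N.
    by rewrite leqNgt prednK ?leqnn.
  by rewrite {1}/chromatic_number; case: ex_minnP => m _; apply.
rewrite -(prednK chi0) in le_chi.
case: hA => -[[_ [_ conn _]] [r btw]].
  apply: embeds_of_between (arc_irrefl (d := D)) (arc_irrefl (d := A)) _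
    (conn r) btw le_chi (n_col _ _) => // u v auv.
  by rewrite /adjacent auv.
have [u|u|u v auv|||f [fI fP]] := @embeds_of_between R D A
  (fun u v => Defs.arc v u) (fun u v => Defs.arc v u) (@adjacent A) r
  _ _ _ _ (conn r) _ le_chi.
- exact: arc_irrefl.
- exact: arc_irrefl.
- by rewrite /adjacent auv orbT.
- by move=> u v; apply: btw.
- by apply: n_col => u v; rewrite /adjacent orbC.
by exists f; split=> // u v /fP.
Qed.
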